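(* Consider a deterministic Markov decision process with continuous state space $\mathcal{S}\subset\mathbb{R}^K$, a deterministic policy $\pi$ with value function $V_\pi$, and $N$ pairwise distinct sample states $s_1,\dots,s_N\in\mathcal{S}$ with successor states $s_1',\dots,s_N'$ under $\pi$. Let $\mathcal{F}(K,n_1,\dots,n_{L-1},1)$ be an MLP architecture with network map $f\colon\mathcal{W}\times\mathbb{R}^K\to\mathbb{R}$ and $N_{net}$ parameters, for which there exists $\mathbf{W}^\circ\in\mathcal{W}$ with $f(\mathbf{W}^\circ,s_i)=V_\pi(s_i)$ for all $i=1,\dots,N$. Let $\widetilde{\mathcal{J}}$ be the sampled Neural Mean Squared Bellman Error. Then the Hessian $\mathsf{H}_{\mathbf{W}}\widetilde{\mathcal{J}}(\mathbf{W}^* )\in\mathbb{R}^{N_{net}\times N_{net}}$ of $\widetilde{\mathcal{J}}$ is at any critical point $\mathbf{W}^*$ of $\widetilde{\mathcal{J}}$ always positive semi-definite. Furthermore, its rank is bounded from above by $$\operatorname{rank}\big(\mathsf{H}_{\mathbf{W}}\widetilde{\mathcal{J}}(\mathbf{W}^* )\big)\le N.$$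
   Context: MDP: compact state space $\mathcal{S}\subset\mathbb{R}^K$, finite action set $\mathcal{A}$, deterministic transitions (each state-action pair has exactly one successor state in $\mathcal{S}$), bounded reward $r\colon\mathcal{S}\times\mathcal{A}\times\mathcal{S}\to[-M,M]$, discount factor $\gamma\in(0,1)$. A deterministic policy is a map $\pi\colon\mathcal{S}\to\mathcal{A}$. The value function is $V_\pi(s)=\sum_{t=0}^\infty\gamma^t r(s_t,\pi(s_t),s_{t+1})$ along the trajectory with $s_0=s$ generated by $\pi$. The successor $s_i'$ of $s_i$ is the state reached by executing action $\pi(s_i)$ in $s_i$. MLP: for $L$ layers with widths $n_0=K,n_1,\dots,n_{L-1},n_L=1$, the parameter space is $\mathcal{W}=\mathbb{R}^{(n_0+1)\times n_1}\times\dots\times\mathbb{R}^{(n_{L-1}+1)\times n_L}$, of dimension $N_{net}=\sum_{l=1}^L(n_{l-1}+1)n_l$, equipped with the Euclidean inner product. For $\mathbf{W}=(W_1,\dots,W_L)$ and input $\phi_0\in\mathbb{R}^K$, define recursively $\phi_l=\sigma_l\!\left(W_l^{\mathsf T}\begin{bmatrix}\phi_{l-1}\\1\end{bmatrix}\right)$ for $l=1,\dots,L$, and $f(\mathbf{W},\phi_0)=\phi_L$. Here $\sigma_L$ is the identity and, for $l<L$, $\sigma_l=\sigma$ is a fixed activation function $\mathbb{R}\to\mathbb{R}$ applied elementwise, which is smooth, unbounded and strictly monotonically increasing. Loss: $\widetilde{\mathcal{J}}(\mathbf{W})=\frac{1}{2N}\sum_{i=1}^N\big(f(\mathbf{W},s_i)-r(s_i,\pi(s_i),s_i')-\gamma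 f(\mathbf{W},s_i')\big)^2$. A critical point of $\widetilde{\mathcal{J}}$ is a $\mathbf{W}^*$ with $\nabla_{\mathbf{W}}\widetilde{\mathcal{J}}(\mathbf{W}^* )=0$. The Hessian is taken with respect to the vectorised parameters. The paper evaluates it at a critical point as (up to the positive factor $\frac1N$) $\big(G(\mathbf{W}^* )-\gamma G'(\mathbf{W}^* )\big)^{\mathsf T}\big(G(\mathbf{W}^* )-\gamma G'(\mathbf{W}^* )\big)$, where $G(\mathbf{W}),G'(\mathbf{W})\in\mathbb{R}^{N\times N_{net}}$ have as their $i$-th rows the vectorised gradients with respect to $\mathbf{W}$ of $f(\mathbf{W},s_i)$ and $f(\mathbf{W},s_i')$, respectively, i.e. with the term involving second derivatives of $f$, which carries the sampled Bellman residuals as factors, taken to vanish at critical points due to the assumption of exact learning at the sample states; the paper titles the result ''Properties of the approximated Hessian''.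
   Formalization: The claim fails for the true Hessian at some critical points with nonzero Bellman residuals; semi-definiteness and the rank bound are proved for the approximated Hessian, and for the true Hessian when the residual-weighted second-derivative term vanishes. *)

(* Defs.v *)
From HB Require Import structures.
From mathcomp Require Import all_boot all_order all_algebra.
From mathcomp Require Import all_classical all_reals all_analysis.

Set Implicit Arguments.
Unset Strict Implicit.
Unset Printing Implicit Defensive.

Import Order.TTheory GRing.Theory Num.Theory.
Import numFieldNormedType.Exports.

Local Open Scope classical_set_scope.
Local Open Scope ring_scope.

(* Transition and reward are total functions, but they are only constrained,
   and only ever evaluated below, on [states]. *)
Record deterministic_mdp (R : realType) (K : nat) (A : finType) := DeterministicMDP {
  states : set 'cV[R]_K;
  transition : 'cV[R]_K -> A -> 'cV[R]_K;
  reward : 'cV[R]_K -> A -> 'cV[R]_K -> R;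
  reward_bound : R;
  discount : R;
  states_compact : compact states;
  transition_states : forall s a, states s -> states (transition s a);
  reward_bounded : forall s a s', states s -> states s' ->
    `|reward s a s'| <= reward_bound;
  discount_gt0 : 0 < discount;
  discount_lt1 : discount < 1
}.

Section Policy.
Variables (R : realType) (K : nat) (A : finType).
Variables (mdp : deterministic_mdp R K A) (pi : 'cV[R]_K -> A).

Definition successor (s : 'cV[R]_K) : 'cV[R]_K := transition mdp s (pi s).

Definition policy_reward (s : 'cV[R]_K) : R := reward mdp s (pi s) (successor s).

Definition trajectory (s : 'cV[R]_K) (t : nat) : 'cV[R]_K := iter t successor s.

Definition value_function (s : 'cV[R]_K) : R :=
  limn (series (fun t => discount mdp ^+ t * policy_reward (trajectory s t))).

End Policy.

Definition smooth (R : realType) (g : R -> R) : Prop :=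
  forall (k : nat) (x : R), derivable (derive1n k g) x 1.

Definition unbounded (R : realType) (g : R -> R) : Prop :=
  forall M : R, exists x : R, M < `|g x|.

(* Number of parameters of a network with input width [k], list of hidden
   widths [hidden] = [:: n_1; ...; n_(L-1)] and output width 1.  The L layers
   are those leading to the L - 1 hidden widths and the output layer. *)
Fixpoint num_params (k : nat) (hidden : seq nat) : nat :=
  if hidden is m :: hidden' then ((k + 1) * m + num_params m hidden')%N
  else ((k + 1) * 1)%N.

(* A parameter is stored vectorised, so that 'rV_(num_params k hidden), with its
   standard basis, plays the role of the product of the spaces of weight
   matrices: [W] is the concatenation of the [mxvec] of the (k + 1) x m weight
   matrices, first layer first.  [mxvec] enumerates the entries of a matrix row
   by row. *)
Fixpoint mlp (R : realType) (sigma : R -> R) (k : nat) (hidden : seq nat) :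
    'rV[R]_(num_params k hidden) -> 'cV[R]_k -> R :=
  match hidden with
  | [::] => fun W phi =>
      ((vec_mx W : 'M[R]_(k + 1, 1))^T *m col_mx phi 1%:M) 0 0
  | m :: hidden' => fun W phi =>
      mlp sigma (rsubmx W)
        (map_mx sigma
           ((vec_mx (lsubmx W) : 'M[R]_(k + 1, m))^T *m col_mx phi 1%:M))
  end.

Section Calculus.
Variables (R : realType) (n : nat).
Implicit Types (g : 'rV[R]_n -> R) (x : 'rV[R]_n).

Definition partial (j : 'I_n) g x : R := 'D_(delta_mx 0 j) g x.

Definition gradient g x : 'rV[R]_n := \row_j partial j g x.

Definition hessian g x : 'M[R]_n := \matrix_(i, j) partial i (partial j g) x.

Definition critical_point g x : Prop := gradient g x = 0.

Definition positive_semidefinite (H : 'M[R]_n) : Prop :=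
  H^T = H /\ forall v : 'cV[R]_n, 0 <= (v^T *m H *m v) 0 0.

End Calculus.

Section BellmanLoss.
Variables (R : realType) (K : nat) (A : finType).
Variables (mdp : deterministic_mdp R K A) (pi : 'cV[R]_K -> A).
Variables (sigma : R -> R) (hidden : seq nat).
Variables (N : nat) (s : 'I_N -> 'cV[R]_K).

Let f (x : 'cV[R]_K) (W : 'rV[R]_(num_params K hidden)) : R := mlp sigma W x.
Let s' (i : 'I_N) : 'cV[R]_K := successor mdp pi (s i).
Let gamma : R := discount mdp.

Definition bellman_residual (i : 'I_N) (W : 'rV[R]_(num_params K hidden)) : R :=
  f (s i) W - policy_reward mdp pi (s i) - gamma * f (s' i) W.

Definition nmsbe (W : 'rV[R]_(num_params K hidden)) : R :=
  (2 * N%:R)^-1 * \sum_(i < N) bellman_residual i W ^+ 2.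

Definition sample_gradients (W : 'rV[R]_(num_params K hidden)) :
    'M[R]_(N, num_params K hidden) := \matrix_(i < N) gradient (f (s i)) W.

Definition successor_gradients (W : 'rV[R]_(num_params K hidden)) :
    'M[R]_(N, num_params K hidden) := \matrix_(i < N) gradient (f (s' i)) W.

(* What remains of the Hessian of [nmsbe] when the second derivatives of the
   network, i.e. [residual_curvature], are left out. *)
Definition approx_hessian (W : 'rV[R]_(num_params K hidden)) :
    'M[R]_(num_params K hidden) :=
  let D := sample_gradients W - gamma *: successor_gradients W in
  N%:R^-1 *: (D^T *m D).

(* This vanishes in particular where all Bellman residuals do. *)
Definition residual_curvature (W : 'rV[R]_(num_params K hidden)) :
    'M[R]_(num_params K hidden) :=
  N%:R^-1 *: \sum_(i < N) bellman_residual i W *: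
    (hessian (f (s i)) W - gamma *: hessian (f (s' i)) W).

End BellmanLoss.

(* Main.v *)
(* With residuals r_i and Jacobian D = G - gamma G', differentiating
   1/(2N) sum_i r_i^2 twice gives 1/N D^T D + 1/N sum_i r_i Hess(r_i).  The first
   term is a Gram matrix, hence positive semi-definite, and it factors through
   R^N.  The analytic content is that the network has iterated partial
   derivatives, which is inherited layer by layer from [sigma]. *)
Require Import Defs.
From HB Require Import structures.
From mathcomp Require Import all_boot all_order all_algebra.
From mathcomp Require Import all_classical all_reals all_analysis.
From mathcomp Require Import lra.

Set Implicit Arguments.
Unset Strict Implicit.
Unset Printing Implicit Defensive.

Import Order.TTheory GRing.Theory Num.Theory.
Import numFieldNormedType.Exports.

Local Open Scope classical_set_scope.
Local Open Scope ring_scope.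

(* Directional rather than Frechet derivatives: the network is built from scalar
   sums, products and compositions with [sigma], so that only the one-variable
   chain rule is needed. *)
Fixpoint iter_derivable (R : realType) (V : normedModType R) (k : nat)
    (g : V -> R) : Prop :=
  if k is k'.+1 then
    forall v, (forall x, derivable g x v) /\ iter_derivable k' ('D_v g)
  else True.

(** * Closure properties of iterated directional derivability *)

Section IterDerivable.
Variables (R : realType) (V : normedModType R).
Implicit Types (f g : V -> R) (x v : V) (k : nat).

Lemma derive_along_line g x v :
  'D_v g x = derive1 (fun t : R => g (t *: v + x)) 0.
Proof.
rewrite /derive /derive1; set d := fun _ => _; set d' := fun _ => _.
suff -> : d = d' by [].
by apply/funext => t; rewrite /d /d' /= addr0 scale0r add0r.
Qed.

(** Restricting [g] to the line through [x] in direction [v] turns this into the one-variable chain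
    rule, so derivability of [g] along [v] alone suffices. *)
Lemma is_derive_scalar_comp (h : R -> R) g x v :
  derivable h (g x) 1 -> derivable g x v ->
  is_derive x v (h \o g) (derive1 h (g x) * 'D_v g x).
Proof.
move=> dh dg.
pose c := fun t : R => g (t *: v + x).
have c0 : c 0 = g x by rewrite /c scale0r add0r.
have dc : derivable c 0 1 by exact: (derivable1P g x v).1.
have dhc : derivable h (c 0) 1 by rewrite c0.
(* In one variable, derivability and differentiability coincide, and the latter is stable under
   composition. *)
have dhgc : derivable (h \o c) 0 1.
  apply/derivable1_diffP; apply: differentiable_comp; exact/derivable1_diffP.
apply: DeriveDef; first exact: (derivable1P _ _ _).2.
by rewrite !derive_along_line -c0 -derive1_comp.
Qed.

Lemma iter_derivable_pred k g : iter_derivable k.+1 g -> iter_derivable k g.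
Proof.
elim: k g => [//|k IH] g dg v; have [dgv d2g] := dg v.
by split => //; apply: IH.
Qed.

Lemma iter_derivable_cst k (c : R) : iter_derivable k (fun _ : V => c).
Proof.
elim: k c => [//|k IH] c v; split=> [x|]; first exact: derivable_cst.
rewrite (_ : 'D_v _ = fun=> 0); first exact: IH.
by apply/funext => x; exact: derive_cst.
Qed.

Lemma iter_derivableD k f g : iter_derivable k f -> iter_derivable k g ->
  iter_derivable k (fun x => f x + g x).
Proof.
elim: k f g => [//|k IH] f g df dg v.
have [dfv d2f] := df v; have [dgv d2g] := dg v.
split=> [x|]; first exact: derivableD.
rewrite (_ : 'D_v _ = fun x => 'D_v f x + 'D_v g x); first exact: IH.
by apply/funext => x; exact: deriveD.
Qed.

(** The product rule pairs each derivative, of order one less, with an undifferentiated factor,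
    which is lowered to that order by [iter_derivable_pred]. *)
Lemma iter_derivableM k f g : iter_derivable k f -> iter_derivable k g ->
  iter_derivable k (fun x => f x * g x).
Proof.
elim: k f g => [//|k IH] f g df dg v.
have [dfv d2f] := df v; have [dgv d2g] := dg v.
split=> [x|]; first exact: derivableM.
rewrite (_ : 'D_v _ = fun x => f x * 'D_v g x + g x * 'D_v f x).
  by apply: iter_derivableD; apply: IH => //; exact: iter_derivable_pred.
by apply/funext => x; exact: deriveM.
Qed.

Lemma iter_derivable_sum k (I : Type) (r : seq I) (F : I -> V -> R) :
  (forall i, iter_derivable k (F i)) ->
  iter_derivable k (fun x => \sum_(i <- r) F i x).
Proof.
move=> dF; elim: r => [|i r IH].
  rewrite (_ : (fun _ => _) = fun=> 0); first exact: iter_derivable_cst.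
  by apply/funext => x; rewrite big_nil.
rewrite (_ : (fun _ => _) = fun x => F i x + \sum_(j <- r) F j x).
  exact: iter_derivableD.
by apply/funext => x; rewrite big_cons.
Qed.

Lemma smooth_derive1 (h : R -> R) : smooth h -> smooth (derive1 h).
Proof. by move=> sh k x; rewrite -derive1Sn; exact: sh. Qed.

(** The chain rule produces [derive1 h \o g], so the induction has to range over all smooth [h]. *)
Lemma iter_derivable_smooth_comp k (h : R -> R) g :
  smooth h -> iter_derivable k g -> iter_derivable k (h \o g).
Proof.
elim: k h g => [//|k IH] h g sh dg v; have [dgv d2g] := dg v.
have dhg x := is_derive_scalar_comp (sh 0%N (g x)) (dgv x).
split=> [x|]; first exact: ex_derive.
rewrite (_ : 'D_v _ = fun x => (derive1 h \o g) x * 'D_v g x).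
  apply: iter_derivableM => //; apply: IH; first exact: smooth_derive1.
  exact: iter_derivable_pred.
by apply/funext => x; rewrite derive_val.
Qed.

End IterDerivable.

(** * Derivability of the network in its parameters *)

Lemma iter_derivable_coord (R : realType) (n k : nat) (j : 'I_n) :
  iter_derivable k (fun x : 'rV[R]_n => x 0 j).
Proof.
case: k => [//|k] v.
have dcoord x : is_derive x v (fun y : 'rV[R]_n => y 0 j) (v 0 j).
  have dj := @differentiable_coord R 1 n x 0 j.
  apply: DeriveDef; first exact: diff_derivable.
  rewrite derive_along_line derive1E.
  (* Along the line, the coordinate is affine in [t] with slope [v 0 j]. *)
  rewrite (_ : (fun _ => _) = v 0 j *: id + cst (x 0 j)).
    by rewrite derive_val addr0 /GRing.scale /= mulr1.
  by apply/funext => t; rewrite !mxE mulrC.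
split=> [x|]; first exact: ex_derive.
rewrite (_ : 'D_v _ = fun=> v 0 j); first exact: iter_derivable_cst.
by apply/funext => x; exact: derive_val.
Qed.

Lemma iter_derivable_affine (R : realType) (V : normedModType R) (d k m : nat)
    (W : V -> 'M[R]_(k + 1, m)) (phi : V -> 'cV[R]_k) (i : 'I_m) :
  (forall a b, iter_derivable d (fun x => W x a b)) ->
  (forall a, iter_derivable d (fun x => phi x a 0)) ->
  iter_derivable d (fun x => ((W x)^T *m col_mx (phi x) 1%:M) i 0).
Proof.
move=> dW dphi.
rewrite (_ : (fun _ => _) =
  fun x => \sum_(a < k + 1) W x a i * col_mx (phi x) (1%:M : 'M[R]_1) a 0).
  apply: iter_derivable_sum => a; apply: iter_derivableM => //.
  (* An entry of the augmented input is either an entry of [phi] or the constant bias input 1. *)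
  rewrite (_ : (fun _ => _) = fun x =>
    match fintype.split a with
    | inl b => phi x b 0
    | inr c => (1%:M : 'M[R]_1) c 0
    end).
    by case: (fintype.split a) => b //; exact: iter_derivable_cst.
  by apply/funext => x; rewrite mxE; case: (fintype.split a).
by apply/funext => x; rewrite mxE; apply: eq_bigr => a _; rewrite mxE.
Qed.

(* The hidden layers feed the parameters into the input of the next layer, hence
   the induction needs an input that varies together with the weights. *)
Lemma iter_derivable_mlp_comp (R : realType) (V : normedModType R) (d : nat)
    (sigma : R -> R) (k : nat) (hidden : seq nat)
    (W : V -> 'rV[R]_(num_params k hidden)) (phi : V -> 'cV[R]_k) :
  smooth sigma ->
  (forall j, iter_derivable d (fun x => W x 0 j)) ->
  (forall a, iter_derivable d (fun x => phi x a 0)) ->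
  iter_derivable d (fun x => mlp sigma (W x) (phi x)).
Proof.
move=> ssigma.
elim: hidden k W phi => [|m hidden IH] k W phi dW dphi /=.
  apply: iter_derivable_affine => // a b.
  rewrite (_ : (fun _ => _) = fun x => W x 0 (mxvec_index a b)) //.
  by apply/funext => x; rewrite mxE.
apply: IH => [j|a].
  (* The right block of [W] holds the later layers; the left block, used below, holds the first
     weight matrix. *)
  rewrite (_ : (fun _ => _) = fun x => W x 0 (rshift _ j)) //.
  by apply/funext => x; rewrite mxE.
rewrite (_ : (fun _ => _) = sigma \o fun x =>
  ((vec_mx (lsubmx (W x)) : 'M[R]_(k + 1, m))^T *m col_mx (phi x) 1%:M) a 0).
  apply: iter_derivable_smooth_comp => //; apply: iter_derivable_affine => //.
  move=> b c; rewrite (_ : (fun _ => _) =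
    fun x => W x 0 (lshift _ (mxvec_index b c))) //.
  by apply/funext => x; rewrite !mxE.
by apply/funext => x; rewrite /= mxE.
Qed.

Lemma iter_derivable_mlp (R : realType) (d : nat) (sigma : R -> R)
    (k : nat) (hidden : seq nat) (phi : 'cV[R]_k) :
  smooth sigma ->
  iter_derivable d (fun W : 'rV_(num_params k hidden) => mlp sigma W phi).
Proof.
move=> ssigma; apply: iter_derivable_mlp_comp => // [j|a].
  exact: iter_derivable_coord.
exact: iter_derivable_cst.
Qed.

(** This is the shape of a Bellman residual: [f] and [g] are the network at a sample and at its
    successor, [c] the reward and [a] the discount. *)
Lemma iter_derivable_affine_combination (R : realType) (V : normedModType R)
    (k : nat) (f g : V -> R) (c a : R) :
  iter_derivable k f -> iter_derivable k g ->
  iter_derivable k (fun x => f x - c - a * g x).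
Proof.
move=> df dg.
rewrite (_ : (fun _ => _) = fun x => (f x + - c) + (- a) * g x).
  apply: iter_derivableD; [apply: iter_derivableD|apply: iter_derivableM] => //;
    exact: iter_derivable_cst.
by apply/funext => x; rewrite mulNr.
Qed.

(** * Gradient and Hessian of a mean of squared residuals *)

Section Hessian.
Variables (R : realType) (n : nat).
Implicit Types (f g : 'rV[R]_n -> R) (x : 'rV[R]_n).

Lemma iter_derivable_partial k (j : 'I_n) g :
  iter_derivable k.+1 g -> iter_derivable k (partial j g).
Proof. by move=> /(_ (delta_mx 0 j))[]. Qed.

Lemma iter_derivable_derivable g x v : iter_derivable 1 g -> derivable g x v.
Proof. by move=> /(_ v)[]. Qed.

Lemma partial_affine_combination (j : 'I_n) f g (c a : R) :
  iter_derivable 1 f -> iter_derivable 1 g ->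
  partial j (fun x => f x - c - a * g x) =
  fun x => partial j f x - a * partial j g x.
Proof.
move=> df dg; apply/funext => x; pose v : 'rV[R]_n := delta_mx 0 j.
have /derivableP df' : derivable f x v by exact: iter_derivable_derivable.
have /derivableP dg' : derivable g x v by exact: iter_derivable_derivable.
have dcomb :=
  is_deriveB (is_deriveB df' (is_derive_cst c x v)) (is_deriveZ a dg').
by apply: etrans (@derive_val _ _ _ _ _ _ _ dcomb) _; rewrite subr0.
Qed.

Lemma gradient_affine_combination f g (c a : R) x :
  iter_derivable 1 f -> iter_derivable 1 g ->
  gradient (fun y => f y - c - a * g y) x = gradient f x - a *: gradient g x.
Proof.
by move=> df dg; apply/rowP => j; rewrite !mxE partial_affine_combination.
Qed.

Lemma hessian_affine_combination f g (c a : R) x :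
  iter_derivable 2 f -> iter_derivable 2 g ->
  hessian (fun y => f y - c - a * g y) x = hessian f x - a *: hessian g x.
Proof.
move=> df dg; apply/matrixP => i j; rewrite !mxE.
rewrite partial_affine_combination; try exact: iter_derivable_pred.
(* Inserting the constant 0 restores the shape of [partial_affine_combination], which then applies a
   second time. *)
rewrite -[X in partial i X](_ :
  (fun y => partial j f y - 0 - a * partial j g y) = _).
  by rewrite partial_affine_combination//; exact: iter_derivable_partial.
by apply/funext => y; rewrite subr0.
Qed.

(** Both differentiations of the loss have this form: first with [f] and [g] the residuals, then
    with [g] their partial derivatives. *)
Lemma partial_sumM (I : finType) (j : 'I_n) (c : R)
    (f g : I -> 'rV[R]_n -> R) :
  (forall i, iter_derivable 1 (f i)) -> (forall i, iter_derivable 1 (g i)) ->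
  partial j (fun x => c * \sum_i f i x * g i x) = fun x =>
    c * \sum_i (f i x * partial j (g i) x + g i x * partial j (f i) x).
Proof.
move=> df dg; apply/funext => x; pose v : 'rV[R]_n := delta_mx 0 j.
have dsum (r : seq I) : is_derive x v (fun y => \sum_(i <- r) f i y * g i y)
    (\sum_(i <- r) (f i x * partial j (g i) x + g i x * partial j (f i) x)).
  elim: r => [|i r IH].
    rewrite big_nil (_ : (fun _ => _) = cst 0); first exact: is_derive_cst.
    by apply/funext => y; rewrite big_nil.
  rewrite big_cons (_ : (fun _ => _) =
    fun y => f i y * g i y + \sum_(k <- r) f k y * g k y).
    apply: is_deriveD; apply: is_deriveM; apply/derivableP;
      exact: iter_derivable_derivable.
  by apply/funext => y; rewrite big_cons.
exact: (@derive_val _ _ _ _ _ _ _ (is_deriveZ c (dsum _))).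
Qed.

Lemma hessian_half_mean_squares (N : nat) (r : 'I_N -> 'rV[R]_n -> R) x
    (J := \matrix_(i < N) gradient (r i) x) :
  (forall i, iter_derivable 2 (r i)) ->
  hessian (fun y => (2 * N%:R)^-1 * \sum_i r i y ^+ 2) x =
  N%:R^-1 *: (J^T *m J) + N%:R^-1 *: \sum_i r i x *: hessian (r i) x.
Proof.
move=> dr; have dr1 i : iter_derivable 1 (r i) by exact: iter_derivable_pred.
apply/matrixP => i j; rewrite !mxE summxE -mulrDr -big_split /=.
have -> : partial j (fun y => (2 * N%:R)^-1 * \sum_i r i y ^+ 2) =
    fun y => N%:R^-1 * \sum_i r i y * partial j (r i) y.
  (* The square is a product by conversion; its two equal product-rule terms cancel the factor
     1/2. *)
  rewrite partial_sumM//; apply/funext => y.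
  rewrite invfM mulrAC mulrC; congr (_ * _); rewrite mulr_sumr.
  by apply: eq_bigr => k _; lra.
rewrite partial_sumM// => [|k]; last exact: iter_derivable_partial.
congr (_ * _); apply: eq_bigr => k _.
by rewrite !mxE [LHS]addrC [X in X + _ = _]mulrC.
Qed.

End Hessian.

(** * Gram matrices and the conclusion *)

Lemma positive_semidefinite_scaled_gram (R : realType) (m n : nat) (c : R)
    (D : 'M[R]_(m, n)) :
  0 <= c -> positive_semidefinite (c *: (D^T *m D)).
Proof.
move=> c0; split; first by rewrite linearZ /= trmx_mul trmxK.
(* The quadratic form at [v] is [c] times the sum of the squared entries of [D *m v]. *)
move=> v; rewrite -scalemxAr -scalemxAl mxE mulr_ge0// mulmxA -trmx_mul -mulmxA.
by rewrite mxE sumr_ge0// => i _; rewrite mxE -expr2 sqr_ge0.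
Qed.

Lemma mxrank_scaled_gram (F : fieldType) (m n : nat) (c : F) (D : 'M[F]_(m, n)) :
  (\rank (c *: (D^T *m D)) <= m)%N.
Proof.
apply: leq_trans (mxrank_scale _ _) _.
exact: leq_trans (mxrankM_maxr _ _) (rank_leq_row _).
Qed.

(** The Gram part has both properties outright. The exact Hessian inherits them where the curvature
    term, weighted by the Bellman residuals, vanishes. *)
Theorem proposition5 (R : realType) (K : nat) (A : finType)
    (mdp : deterministic_mdp R K A) (pi : 'cV[R]_K -> A)
    (sigma : R -> R) (hidden : seq nat)
    (N : nat) (s : 'I_N -> 'cV[R]_K)
    (N_gt0 : (0 < N)%N)
    (sigma_smooth : smooth sigma)
    (sigma_unbounded : unbounded sigma)
    (sigma_increasing : {homo sigma : x y / x < y})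
    (s_states : forall i, states mdp (s i))
    (s_distinct : injective s)
    (exact_learning : exists W0 : 'rV[R]_(num_params K hidden),
       forall i, mlp sigma W0 (s i) = value_function mdp pi (s i))
    (W : 'rV[R]_(num_params K hidden))
    (W_critical : critical_point (nmsbe mdp pi sigma s) W) :
  let H := hessian (nmsbe mdp pi sigma s) W in
  let H_approx := approx_hessian mdp pi sigma s W in
  let curvature := residual_curvature mdp pi sigma s W in
  [/\ H = H_approx + curvature,
      positive_semidefinite H_approx,
      (\rank H_approx <= N)%N &
      curvature = 0 -> positive_semidefinite H /\ (\rank H <= N)%N].
Proof.
move=> H H_approx curvature.
have psd : positive_semidefinite H_approx.
  by apply: positive_semidefinite_scaled_gram; rewrite invr_ge0.
have rk : (\rank H_approx <= N)%N by exact: mxrank_scaled_gram.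
have dmlp d x := iter_derivable_mlp d hidden x sigma_smooth.
have HE : H = H_approx + curvature.
  rewrite /H hessian_half_mean_squares => [|i].
    congr (_ + _); rewrite /H_approx /approx_hessian.
      (* The Jacobian of the residuals is compared row by row with the difference of the two
         gradient matrices. *)
      set J := (X in _ *: (X^T *m X)); set D := sample_gradients _ _ _ - _.
      suff -> : J = D by [].
      apply/row_matrixP => i; rewrite linearB linearZ /= !rowK.
      by rewrite gradient_affine_combination.
    by congr (_ *: _); apply: eq_bigr => i _; rewrite hessian_affine_combination.
  exact: iter_derivable_affine_combination.
split=> // curv0.
by rewrite HE curv0 addr0.
Qed.
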